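(* Let $n\ge2$, let $\mathcal{P}$ be a probability distribution on $\mathcal{Z}=\mathcal{X}\times\mathcal{Y}$, let $\mathcal{A}:\mathcal{Z}^{n-1}\to\mathcal{W}\subseteq\mathbb{R}^K$ be a possibly stochastic training algorithm, and let $\ell:\mathcal{W}\times\mathcal{Z}\to[0,1]$ be a (measurable) loss. Then \[ \mathrm{gen}(\mathcal{A})\le \frac{c_n}{\sqrt2}\,\mathbb{E}_{z^n\sim\mathcal{P}^n}\sqrt{\mathrm{loo\text{-}CMI}(\mathcal{A},z^n)},\qquad c_n=\frac{n}{n-1}. \]
   Context: The algorithm's internal randomness is independent of the data and of the index $U$ below. True loss: $\mathcal{L}(w)=\mathbb{E}_{Z'\sim\mathcal{P}}[\ell(w,Z')]$; empirical loss on $z^m$: $\widehat{\mathcal{L}}(w,z^m)=\frac1m\sum_{i=1}^m\ell(w,z_i)$. Generalization gap: $\mathrm{gen}(\mathcal{A})=\big|\mathbb{E}\big[\mathcal{L}(\mathcal{A}(Z^{n-1}))-\widehat{\mathcal{L}}(\mathcal{A}(Z^{n-1}),Z^{n-1})\big]\big|$, where $Z^{n-1}\sim\mathcal{P}^{n-1}$ and the expectation is also over the randomness of $\mathcal{A}$. For $z^n\in\mathcal{Z}^n$ and $u\in[n]$, $z^{n-1}_{-u}$ denotes the $(n-1)$-tuple obtained from $z^n$ by deleting $z_u$. Let $U$ be uniform on $[n]$ and, for fixed $z^n$, $W=\mathcal{A}(z^{n-1}_{-U})$. The pointwise leave-one-out conditional mutual information is $\mathrm{loo\text{-}CMI}(\mathcal{A},z^n)=I(W;U\mid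 Z^n=z^n)$, i.e. the mutual information between $W$ and $U$ when the full dataset is fixed to $z^n$. *)

(* Defs.v *)
From HB Require Import structures.
From mathcomp Require Import all_boot all_order all_algebra.
From mathcomp Require Import all_classical all_reals all_analysis.
Set Implicit Arguments. Unset Strict Implicit. Unset Printing Implicit Defensive.
Import Order.TTheory GRing.Theory Num.Theory.
Import numFieldNormedType.Exports.
Local Open Scope classical_set_scope.
Local Open Scope ring_scope.

Definition del_tuple (T : Type) (n : nat) (t : n.-tuple T) (u : 'I_n)
  : (n.-1).-tuple T := [tuple tnth t (lift u j) | j < n.-1].

Definition emp_loss (W Z : Type) (R : realType) (m : nat)
  (loss : W -> Z -> R) (w : W) (zs : m.-tuple Z) : R :=
  (m%:R)^-1 * \sum_(i < m) loss w (tnth zs i).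

Definition true_loss d (Z : measurableType d) (W : Type) (R : realType)
  (P : probability Z R) (loss : W -> Z -> R) (w : W) : \bar R :=
  (\int[P]_z (loss w z)%:E)%E.

Section mixture.
Context d (T : measurableType d) (R : realType) (n : nat)
  (mu : 'I_n -> probability T R).

Definition mix_seq : {measure set T -> \bar R}^nat := fun k =>
  match insub k with
  | Some u => (mu u : {measure set T -> \bar R})
  | None => mzero
  end.

Definition mixture : set T -> \bar R :=
  mscale (n%:R^-1)%:nng (msum mix_seq n).

HB.instance Definition _ := Measure.on mixture.

Let mixture_fin : fin_num_fun mixture.
Proof.
move=> A mA; rewrite /mixture /mscale /= /msum fin_numM //.
apply/sum_fin_numP => k _ _; rewrite /mix_seq.
case: insubP => [u _ _|_] /=; last by [].
exact: fin_num_measure.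
Qed.

HB.instance Definition _ := @Measure_isFinite.Build _ T _ mixture mixture_fin.

End mixture.

Section kernel_prob.
Context d d' (X : measurableType d) (Y : measurableType d') (R : realType)
  (k : R.-pker X ~> Y) (x : X).

Definition kprob : set Y -> \bar R := k x.
HB.instance Definition _ := Measure.on kprob.
HB.instance Definition _ :=
  @Measure_isProbability.Build _ Y R kprob (@prob_kernel _ _ X Y R k x).
End kernel_prob.

Definition KL d (T : measurableType d) (R : realType)
  (mu : {finite_measure set T -> \bar R})
  (nu : {sigma_finite_measure set T -> \bar R}) : \bar R :=
  if pselect (charge_of_finite_measure mu `<< nu)
  then (\int[mu]_x
          (ln (fine (Radon_Nikodym (charge_of_finite_measure mu) nu x)))%:E)%E
  else +oo%E.

(* Pointwise leave-one-out CMI.  For fixed z^n, U uniform on [n] and        *)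
(* W = A(z^{n-1}_{-U}) with conditional law P_{W|U=u} = A(z^{n-1}_{-u}),    *)
(* P_W = (1/n) sum_u A(z^{n-1}_{-u}), and                                   *)
(*   I(W;U | Z^n = z^n) = sum_u P(U=u) D(P_{W|U=u} || P_W).                 *)
Definition loo_CMI dZ dW (Z : measurableType dZ) (W : measurableType dW)
  (R : realType) (n : nat) (A : R.-pker ((n.-1).-tuple Z) ~> W)
  (zn : n.-tuple Z) : \bar R :=
  let Q := fun u : 'I_n => (kprob A (del_tuple zn u) : probability W R) in
  ((n%:R^-1)%:E * \sum_(u < n) KL (Q u) (mixture Q))%E.

(* The random variable S : Omega -> m.-tuple Z has law P^m (i.i.d. with law  *)
(* P): it is measurable and its law agrees with the m-fold product of P on  *)
(* all measurable rectangles (which determine the product measure).         *)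
Definition iid_sample d dO (Z : measurableType d) (O : measurableType dO)
  (R : realType) (Pr : probability O R) (P : probability Z R) (m : nat)
  (S : O -> m.-tuple Z) : Prop :=
  measurable_fun setT S /\
  forall B : 'I_m -> set Z, (forall i, measurable (B i)) ->
    Pr (S @^-1` [set t | forall i, B i (tnth t i)]) = (\prod_(i < m) P (B i))%E.

(* Generalization gap  | E[ L(A(Z^{n-1})) - \hat L(A(Z^{n-1}), Z^{n-1}) ] |, *)
(* Z^{n-1} = S' ~ P^{n-1}, expectation over data (Pr) and the algorithm's   *)
(* internal randomness (the kernel A).                                      *)
Definition gen dZ dW dO (Z : measurableType dZ) (W : measurableType dW)
  (O : measurableType dO) (R : realType) (m : nat)
  (Pr : probability O R) (P : probability Z R)
  (A : R.-pker (m.-tuple Z) ~> W) (loss : W -> Z -> R)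
  (S' : O -> m.-tuple Z) : \bar R :=
  `| \int[Pr]_o \int[A (S' o)]_w
        (true_loss P loss w - (emp_loss loss w (S' o))%:E) |%E.

(* Main.v *)
(* For fixed z^n put Q_u = A(z_{-u}), M the uniform mixture of the Q_u and
   f_u = loss(., z_u).  Exchangeability of the sample identifies the signed
   generalization gap with the expectation over z^n of n/(n-1) times
     D = (1/n) sum_u (E_{Q_u} f_u - E_M f_u).
   For g = dQ/dM and f with values in [0,1], integrating against M the inequality
     l (f - 1/2)(g - 1) - l^2 (g + 2)/24 + g - 1 <= g ln g
   gives l (E_Q f - E_M f) - l^2/8 <= KL(Q, M) for every real l.  This is linear
   in Q and KL, so it may be averaged over u; l = 4 D then gives 2 D^2 <= CMI.
   The CMI need not be known to be measurable in z^n, because the Lebesgue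
   integral is monotone without measurability assumptions. *)
Require Import Defs.
From HB Require Import structures.
From mathcomp Require Import all_boot all_order all_algebra.
From mathcomp Require Import ring lra.
From mathcomp Require Import all_classical all_reals all_analysis.
From mathcomp Require Import measurable_realfun.
Import Order.TTheory GRing.Theory Num.Theory.
Import numFieldNormedType.Exports.
Local Open Scope classical_set_scope.
Local Open Scope ring_scope.

Set Implicit Arguments. Unset Strict Implicit. Unset Printing Implicit Defensive.

(** * Scalar inequalities for the logarithm *)

Section scalar.
Context {R : realType}.
Implicit Types r c l : R.

(** The rational function comes from solving [3 (r - 1)^2 = 2 (r + 2) (r ln r - r + 1)] for [ln r];
    it agrees with [ln] to third order at 1. *)
Let phi (r : R) := ln r - (r - 1) * (5 * r + 1) / (2 * r * (r + 2)).

Let is_derive_phi r : 0 < r ->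
  is_derive r 1 phi ((r - 1) ^+ 3 / (r ^+ 2 * (r + 2) ^+ 2)).
Proof.
move=> r0.
have r2 : r * (r + 2) != 0 by apply: lt0r_neq0; nra.
have rn0 : r != 0 by apply: lt0r_neq0.
have r2n0 : r + 2 != 0 by apply: lt0r_neq0; lra.
have dln := is_derive1_ln r0.
have dpoly : is_derive r 1 (fun x : R => 2^-1 * ((x - 1) * (5 * x + 1)))
  (2^-1 * (10 * r - 4)).
  by apply: is_derive_eq; rewrite /GRing.scale/=; ring.
have dden : is_derive r 1 (fun x : R => x * (x + 2)) (2 * r + 2).
  by apply: is_derive_eq; rewrite /GRing.scale/=; ring.
have dinv := is_deriveV (f := fun x : R => x * (x + 2)) r2 dden.
have dquo := is_deriveM dpoly dinv.
have dphi := is_deriveB dln dquo.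
have -> : phi = (ln (R:=R)) - ((fun x : R => 2^-1 * ((x - 1) * (5 * x + 1))) *
   (fun x : R => (x * (x + 2))^-1)).
  apply/funext => x.
  rewrite /phi !fctE /= -[2 * x * _]mulrA (invfM 2).
  by set u := (x * _)^-1; ring.
apply: is_derive_eq; rewrite /GRing.scale/=.
by field; rewrite rn0 r2n0.
Qed.

(** [phi] vanishes at 1 and its derivative has the sign of [(r - 1)^3], so 1 is its minimum on the
    positive axis. The mean value theorem is applied on each side of 1. *)
Lemma ln_ge_rational r : 0 < r ->
  (r - 1) * (5 * r + 1) / (2 * r * (r + 2)) <= ln r.
Proof.
move=> r0; rewrite -subr_ge0 -/(phi r).
have phi1 : phi 1 = 0 by rewrite /phi ln1 subrr !mul0r subrr.
have cphi x : 0 < x -> {for x, continuous phi}.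
  move=> x0; apply: differentiable_continuous.
  by have [/derivable1_diffP] := is_derive_phi x0.
have q0 (x : R) : 0 <= x ^+ 2 * (x + 2) ^+ 2 by rewrite mulr_ge0 ?sqr_ge0.
have [r1|r1] := leP 1 r.
  have [x||c] := @MVT_segment R phi
      (fun r => (r - 1) ^+ 3 / (r ^+ 2 * (r + 2) ^+ 2)) 1 r r1.
  - by rewrite in_itv/= => /andP[x1 _]; apply: is_derive_phi; lra.
  - apply: continuous_in_subspaceT => x; rewrite inE/= in_itv/= => /andP[x1 _].
    by apply: cphi; lra.
  rewrite in_itv/= => /andP[c1 _]; rewrite phi1 subr0 => ->.
  by rewrite mulr_ge0 ?subr_ge0// divr_ge0// exprn_ge0// subr_ge0.
have [x||c] := @MVT_segment R phi
      (fun r => (r - 1) ^+ 3 / (r ^+ 2 * (r + 2) ^+ 2)) r 1 (ltW r1).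
- by rewrite in_itv/= => /andP[x1 _]; apply: is_derive_phi; lra.
- apply: continuous_in_subspaceT => x; rewrite inE/= in_itv/= => /andP[x1 _].
  by apply: cphi; lra.
rewrite in_itv/= => /andP[_ c1]; rewrite phi1 sub0r => /eqP.
rewrite eqr_oppLR => /eqP ->.
rewrite -mulNr mulr_ge0 ?subr_ge0 ?(ltW r1)// -mulNr divr_ge0//.
by rewrite exprS mulrC -mulrN mulr_ge0 ?sqr_ge0 ?oppr_ge0 ?subr_le0.
Qed.

(** The scalar inequality behind Pinsker's inequality: [ln_ge_rational] with denominators cleared.
    At [r = 0] it reads [3 <= 4]. *)
Lemma sqr_le_xlnx r : 0 <= r ->
  3 * (r - 1) ^+ 2 <= 2 * (r + 2) * (r * ln r - r + 1).
Proof.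
rewrite le_eqVlt => /predU1P[<-|r0]; first by rewrite ln0//; lra.
have := ln_ge_rational r0; rewrite ler_pdivrMr; last by nra.
by nra.
Qed.

(** With [x = l^2 (r + 2) / 24] and [y = r ln r - r + 1], the square of [l (c - 1/2) (r - 1)] is at
    most [4 x y], hence at most [(x + y)^2]. The factor 1/24 makes [x] average to [l^2 / 8] when [r]
    has mean 1. *)
Lemma pinsker_pointwise l c r : 0 <= c <= 1 -> 0 <= r ->
  l * (c - 2^-1) * (r - 1) - l ^+ 2 * (r + 2) / 24 + r - 1 <= r * ln r.
Proof.
move=> /andP[c0 c1] r0.
have H := sqr_le_xlnx r0.
set y := r * ln r - r + 1 in H.
have y0 : 0 <= y.
  rewrite -(@pmulr_rge0 _ (2 * (r + 2))); last by lra.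
  by apply: le_trans H; rewrite mulr_ge0 ?sqr_ge0.
set x := l ^+ 2 * (r + 2) / 24.
have x0 : 0 <= x.
  by rewrite /x divr_ge0// mulr_ge0 ?sqr_ge0//; lra.
suff : l * (c - 2^-1) * (r - 1) <= x + y by rewrite /y; lra.
apply: le_trans (ler_norm _) _.
have xy0 : 0 <= x + y by exact: addr_ge0.
rewrite -(@ler_pXn2r _ 2)// ?nnegrE ?normr_ge0// real_normK ?num_real//.
have hc : (c - 2^-1) ^+ 2 <= 4^-1 by nra.
have xy : (l * (r - 1)) ^+ 2 <= 16 * (x * y).
  rewrite /x; have := ler_wpM2l (sqr_ge0 l) H.
  by rewrite exprMn; lra.
have : (l * (c - 2^-1) * (r - 1)) ^+ 2 <= 4 * (x * y).
  rewrite (_ : (l * (c - 2^-1) * (r - 1)) ^+ 2 =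
    (c - 2^-1) ^+ 2 * (l * (r - 1)) ^+ 2); last by ring.
  have := ler_wpM2r (sqr_ge0 (l * (r - 1))) hc; lra.
by have := sqr_ge0 (x - y); nra.
Qed.

End scalar.

(** * Monotonicity of the integral and integrability of bounded functions *)

Section real_integral.
Context d (T : measurableType d) (R : realType).
Variable mu : {measure set T -> \bar R}.
Local Open Scope ereal_scope.

Lemma le_integral_pointwise (f g : T -> \bar R) :
  (forall x, f x <= g x) -> \int[mu]_x f x <= \int[mu]_x g x.
Proof.
(* The positive and negative parts are integrated as suprema over simple
   functions, so no measurability is needed. *)
have le0 (u v : T -> \bar R) : (forall x, 0 <= u x) ->
    (forall x, u x <= v x) -> \int[mu]_x u x <= \int[mu]_x v x.
  move=> u0 uv; rewrite !ge0_integralTE//; last by move=> x; apply: le_trans (uv x).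
  apply: le_ereal_sup => _ [h hu <-]; exists h => //= x.
  exact: le_trans (uv x).
move=> fg; rewrite integralE [leRHS]integralE.
by apply: leeB; apply: le0 => // x;
  [apply: (@funepos_le _ _ setT)|apply: (@funeneg_le _ _ setT)];
  rewrite ?inE// => y _.
Qed.

End real_integral.

Lemma integrable_01 d (T : measurableType d) (R : realType)
    (mu : {finite_measure set T -> \bar R}) (f : T -> R) :
  measurable_fun setT f -> (forall x, 0 <= f x <= 1) ->
  mu.-integrable setT (EFin \o f).
Proof.
move=> mf f01; apply: (le_integrable measurableT _ _
    (finite_measure_integrable_cst mu 1 measurableT)).
  exact/measurable_EFinP.
by move=> x _; have /andP[? ?] := f01 x; rewrite /= normr1 lee_fin ger0_norm.
Qed.

(** * A variational lower bound for relative entropy *)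

Section relative_entropy.
Context d (T : measurableType d) (R : realType).
Variables Q M : {finite_measure set T -> \bar R}.
Hypothesis QM : Q `<< M.

(** This version of the density is finite and nonnegative at every point, so the scalar inequality
    applies pointwise. The version used in [KL] agrees with it almost everywhere. *)
Let g x := fine (Radon_Nikodym_SigmaFinite.f Q M x).

Let gE x : (g x)%:E = Radon_Nikodym_SigmaFinite.f Q M x.
Proof. by rewrite fineK// Radon_Nikodym_SigmaFinite.f_fin_num. Qed.

Let g_ge0 x : 0 <= g x.
Proof. by rewrite -lee_fin gE Radon_Nikodym_SigmaFinite.f_ge0. Qed.

Let g_int : M.-integrable setT (EFin \o g).
Proof.
rewrite (_ : EFin \o g = Radon_Nikodym_SigmaFinite.f Q M); last first.
  by apply/funext => x; rewrite /= gE.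
exact: Radon_Nikodym_SigmaFinite.f_integrable.
Qed.

Let mg : measurable_fun setT g.
Proof. exact/measurable_EFinP/(measurable_int _ g_int). Qed.

(** Multiplication by [g >= 0] commutes with taking positive and negative parts, which reduces the
    signed case to the change of variables for nonnegative functions. *)
Let integral_density (f : T -> \bar R) : measurable_fun setT f ->
  (\int[Q]_x f x = \int[M]_x (f x * (g x)%:E))%E.
Proof.
move=> mf; rewrite integralE [RHS]integralE.
rewrite -!(Radon_Nikodym_SigmaFinite.change_of_variables QM)//; last 2 first.
  exact: measurable_funeneg.
  exact: measurable_funepos.
congr (_ - _)%E; apply: eq_integral => x _; rewrite -gE.
  by rewrite !funeposE muleC maxe_pMr ?lee_fin// mule0 muleC.
by rewrite !funenegE muleC maxe_pMr ?lee_fin// mule0 muleN muleC.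
Qed.

(** The two versions of the density differ on an [M]-null set, which is [Q]-null by domination; then
    [Q] is replaced by [g] times [M]. *)
Let KLE : KL Q M = (\int[M]_x (g x * ln (g x))%:E)%E.
Proof.
rewrite /KL; case: pselect => //= _.
under [RHS]eq_integral do rewrite mulrC EFinM.
have mln : measurable_fun setT (fun x => (ln (g x))%:E).
  by apply/measurable_EFinP; exact: measurableT_comp.
rewrite -[RHS](integral_density mln).
apply: ae_eq_integral => //.
  apply/measurable_EFinP; apply: measurableT_comp => //.
  exact: measurableT_comp.
apply: null_dominates_ae_eq QM _ => //.
apply: ae_eq_sym.
exact: (ae_eq_comp (fun y => (ln (fine y))%:E)
  (ae_eq_Radon_Nikodym_SigmaFinite QM measurableT)).
Qed.

(* Hoeffding's bound on the log-moment generating function, in its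
   Donsker-Varadhan dual form. *)
Lemma KL_ge_expectation_gap (f : T -> R) (l : R) :
  Q setT = 1%E -> M setT = 1%E ->
  measurable_fun setT f -> (forall x, 0 <= f x <= 1) ->
  ((l * (\int[Q]_x f x - \int[M]_x f x) - l ^+ 2 / 8)%:E <= KL Q M)%E.
Proof.
move=> Q1 M1 mf f01.
have fi := integrable_01 M mf f01.
have fgi : M.-integrable setT (EFin \o (fun x => f x * g x)).
  apply: (le_integrable measurableT _ _ g_int).
    by apply/measurable_EFinP; exact: measurable_funM.
  move=> x _; rewrite /= lee_fin normrM ler_piMl//.
  by have /andP[? ?] := f01 x; rewrite ger0_norm.
(* Expanding the left side of [pinsker_pointwise] in [f] and [g] leaves [c1] as the coefficient of
   [g] and [c2] as the constant. As [g] has mean 1, they contribute [c1 + c2 = - l^2 / 8]. *)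
pose c1 := 1 - l / 2 - l ^+ 2 / 24.
pose c2 := l / 2 - l ^+ 2 / 12 - 1.
have i1 : M.-integrable setT (EFin \o (fun x => l * (f x * g x))).
  by rewrite (_ : _ \o _ = (fun x => l%:E * (f x * g x)%:E)%E)//; exact: integrableZl.
have i2 : M.-integrable setT (EFin \o (fun x => (- l) * f x)).
  by rewrite (_ : _ \o _ = (fun x => (- l)%:E * (f x)%:E)%E)//; exact: integrableZl.
have i3 : M.-integrable setT (EFin \o (fun x => c1 * g x)).
  by rewrite (_ : _ \o _ = (fun x => c1%:E * (g x)%:E)%E)//; exact: integrableZl.
have i4 : M.-integrable setT (EFin \o (fun=> c2)).
  exact: finite_measure_integrable_cst.
have i12 : M.-integrable setT (EFin \o (fun x => l * (f x * g x) + - l * f x)).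
  exact: integrableD i1 i2.
have i34 : M.-integrable setT (EFin \o (fun x => c1 * g x + c2)).
  exact: integrableD i3 i4.
have Qf : \int[Q]_x f x = \int[M]_x (f x * g x).
  by rewrite /Rintegral integral_density//; exact/measurable_EFinP.
have Mg : \int[M]_x g x = 1.
  rewrite /Rintegral; under eq_integral do rewrite gE.
  by rewrite -Radon_Nikodym_SigmaFinite.f_integral// Q1.
have -> : (l * (\int[Q]_x f x - \int[M]_x f x) - l ^+ 2 / 8)%:E =
    (\int[M]_x (l * (f x * g x) + - l * f x + (c1 * g x + c2))%:E)%E.
  rewrite -[RHS]fineK; last exact: integrable_fin_num (integrableD _ i12 i34).
  rewrite -/(Rintegral _ _ _) RintegralD// RintegralD// RintegralD//.
  rewrite !RintegralZl// Rintegral_cst// [X in fine X]M1 Mg Qf /c1 /c2 /=.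
  by congr EFin; field.
(* The comparison takes place in the extended reals, so the integral of [g ln g] may be infinite. *)
rewrite KLE; apply: le_integral_pointwise => x.
rewrite lee_fin; apply: le_trans (pinsker_pointwise l (f01 x) (g_ge0 x)).
by rewrite le_eqVlt; apply/orP; left; apply/eqP; rewrite /c1 /c2; field.
Qed.

End relative_entropy.

(** * Uniform mixtures and leave-one-out averages *)

Section uniform_mixture.
Context d (T : measurableType d) (R : realType) (n : nat).
Variable mu : 'I_n.+1 -> probability T R.
Local Open Scope ereal_scope.

Let mix_seqE (u : 'I_n.+1) : mix_seq mu u = mu u :> {measure set T -> \bar R}.
Proof. by rewrite /mix_seq valK. Qed.

Lemma mixtureE A :
  mixture mu A = (n.+1%:R^-1)%:E * \sum_(u < n.+1) mu u A.
Proof.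
rewrite /mixture /mscale/= /msum; congr (_ * _).
by apply: eq_bigr => u _; rewrite mix_seqE.
Qed.

Lemma mixture_setT : mixture mu setT = 1.
Proof.
rewrite mixtureE (eq_bigr (fun=> 1)); last by move=> u _; rewrite probability_setT.
by rewrite sumEFin -EFinM sumr_const card_ord mulVf.
Qed.

(** A vanishing sum of nonnegative terms has vanishing terms. Domination puts [KL] in its integral
    branch. *)
Lemma dominates_mixture u : mu u `<< mixture mu.
Proof.
apply/null_content_dominatesP => A mA; rewrite [X in X = 0 -> _]mixtureE => /eqP.
rewrite mule_eq0 eqe invr_eq0 pnatr_eq0/= => /eqP mu0; apply/eqP.
by rewrite eq_le measure_ge0 andbT -mu0 (bigD1 u)//= leeDl// sume_ge0.
Qed.

Lemma Rintegral_mixture (f : T -> R) :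
  measurable_fun setT f -> (forall x, 0 <= f x <= 1)%R ->
  (\int[mixture mu]_x f x = n.+1%:R^-1 * \sum_(u < n.+1) \int[mu u]_x f x)%R.
Proof.
move=> mf f01; have f0 x : 0 <= (f x)%:E by rewrite lee_fin; have /andP[] := f01 x.
have mf' : measurable_fun setT (EFin \o f) by exact/measurable_EFinP.
rewrite /Rintegral ge0_integral_mscale//= ge0_integral_measure_sum//.
rewrite (eq_bigr (fun u => \int[mu u]_x (f x)%:E)); last first.
  by move=> u _; rewrite mix_seqE.
have fin u : \int[mu u]_x (f x)%:E \is a fin_num.
  by apply: integrable_fin_num => //; exact: integrable_01.
rewrite fineM//; last by apply/sum_fin_numP => u _ _; exact: fin.
by rewrite -sum_fine// => u _; exact: fin.
Qed.

Lemma expectation_gap_mixture (f : 'I_n.+1 -> T -> R) :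
  (forall u, measurable_fun setT (f u)) -> (forall u x, 0 <= f u x <= 1)%R ->
  (`|n.+1%:R^-1 * \sum_(u < n.+1)
      (\int[mu u]_x f u x - \int[mixture mu]_x f u x)|%R)%:E <=
  ((Num.sqrt 2)^-1)%:E *
    sqrte ((n.+1%:R^-1)%:E * \sum_(u < n.+1) KL (mu u) (mixture mu)).
Proof.
move=> mf f01; set D := (n.+1%:R^-1 * _)%R; set I := (X in sqrte X).
(* The choice [l = 4 D], the same for every [u], maximises [l D - l^2 / 8], with value [2 D^2]. *)
have DI : (2 * D ^+ 2)%:E <= I.
  have -> : (2 * D ^+ 2)%R = (n.+1%:R^-1 * \sum_(u < n.+1)
      (4 * D * (\int[mu u]_x f u x - \int[mixture mu]_x f u x)
        - (4 * D) ^+ 2 / 8))%R.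
    rewrite sumrB -mulr_sumr sumr_const card_ord -[X in (_ - X)%R]mulr_natl.
    rewrite mulrBr [X in (X - _)%R]mulrCA -/D mulrA mulVf// mul1r; by field.
  rewrite EFinM -sumEFin lee_wpmul2l ?lee_fin ?invr_ge0// lee_sum// => u _.
  apply: KL_ge_expectation_gap => //; first exact: dominates_mixture.
  - exact: probability_setT.
  - exact: mixture_setT.
have -> : (`|D|%R)%:E = ((Num.sqrt 2)^-1)%:E * sqrte (2 * D ^+ 2)%:E.
  have s2 : Num.sqrt 2 != 0%R :> R by rewrite sqrtr_eq0 -ltNge.
  by rewrite /= sqrtrM// sqrtr_sqr -EFinM mulrA mulVf// mul1r.
rewrite lee_wpmul2l ?lee_fin ?invr_ge0 ?sqrtr_ge0// lee_sqrt//.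
by apply: le_trans DI; rewrite lee_fin mulr_ge0 ?sqr_ge0.
Qed.

End uniform_mixture.

(** Here [a u v] stands for the loss at point [v] after training without point [u]. Completing each
    training sum by its missing term [a u u] raises the weight of that term to
    [1 + 1/(n-1) = n/(n-1)] for a sample of size [n]; this is the origin of [c_n]. Exchanging the
    double sum gives averages over the trained models. *)
Lemma leave_one_out_average (R : realType) (n : nat) (a : 'I_n.+2 -> 'I_n.+2 -> R) :
  n.+2%:R^-1 * \sum_u (a u u - n.+1%:R^-1 * \sum_(j < n.+1) a u (lift u j)) =
  n.+2%:R / n.+1%:R *
    (n.+2%:R^-1 * \sum_u (a u u - n.+2%:R^-1 * \sum_v a v u)).
Proof.
have lift_sum u : \sum_(j < n.+1) a u (lift u j) = \sum_v a u v - a u u.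
  by rewrite (bigD1_ord u)//= addrC addrK.
under eq_bigr do rewrite lift_sum.
rewrite !sumrB -!mulr_sumr sumrB [X in _ = _ * (_ * (_ - _ * X))]exchange_big/=.
set x := \sum_u a u u; set y := \sum_u \sum_v _.
rewrite -[n.+2%:R]natr1.
have n1 : n.+1%:R != 0 :> R by rewrite pnatr_eq0.
have n2 : n.+1%:R + 1 != 0 :> R by rewrite natr1 pnatr_eq0.
by move: (n.+1%:R) n1 n2 => N n1 n2; field; rewrite n1 n2.
Qed.

(** * Uniqueness of finite measures on tuples *)

Section tuple_boxes.
Context d (Z : measurableType d) (m : nat).

Let box (B : 'I_m -> set Z) := [set t : m.-tuple Z | forall i, B i (tnth t i)].

Let measurable_box B : (forall i, measurable (B i)) -> measurable (box B).
Proof.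
move=> mB; rewrite (_ : box B = \bigcap_(i in setT) ((@tnth _ Z ^~ i) @^-1` B i)).
  apply: fin_bigcap_measurable => [|i _]; first exact: finite_finset.
  by rewrite -[X in measurable X]setTI; exact: measurable_tnth.
by apply/seteqP; split => t /= Bt i => [_|]; exact: Bt.
Qed.

(** Boxes are stable under intersection and generate the sigma-algebra of tuples. This turns the
    description of a law in [iid_sample] into equality on all measurable sets. *)
Lemma tuple_measure_unique (R : realType)
    (m1 m2 : {measure set (m.-tuple Z) -> \bar R}) :
  (m1 setT < +oo)%E ->
  (forall B : 'I_m -> set Z, (forall i, measurable (B i)) ->
    m1 [set t | forall i, B i (tnth t i)] =
    m2 [set t | forall i, B i (tnth t i)]) ->
  forall A, measurable A -> m1 A = m2 A.
Proof.
move=> m1oo m12 A mA.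
pose G := [set X | exists2 B, (forall i, measurable (B i)) & X = box B].
have boxT : box (fun=> setT) = setT by apply/seteqP; split.
apply: (measure_unique G (fun=> setT)) => //.
- apply/seteqP; split; last first.
    apply: smallest_sub; first exact: sigma_algebra_measurable.
    by move=> _ [B mB ->]; exact: measurable_box.
  apply: sub_smallest2r; first exact: smallest_sigma_algebra.
  move=> X; rewrite -bigcup_seq => -[i _ [Y mY <-]].
  (* A cylinder over coordinate [i] is the box whose other sides are the whole space. *)
  exists (fun j => if j == i then Y else setT).
    by move=> j; case: ifP.
  rewrite setTI; apply/seteqP; split => t /=.
    by move=> Yt j; case: eqP => // ->.
  by move=> /(_ i); rewrite eqxx.
- move=> _ _ [B mB ->] [C mC ->]; exists (fun i => B i `&` C i).
    by move=> i; exact: measurableI.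
  by apply/seteqP; split => t /=;
    [move=> [Bt Ct] i; split|move=> BCt; split=> i; have [] := BCt i].
- by move=> _; exists (fun=> setT).
- by rewrite bigcup_const//; exists 0%N.
- by move=> _ [B mB ->]; exact: m12.
Qed.

End tuple_boxes.

Lemma measurable_del_tuple d (Z : measurableType d) (m : nat) (u : 'I_m) :
  measurable_fun setT (fun t : m.-tuple Z => del_tuple t u).
Proof.
apply/measurable_fun_tnthP => j.
rewrite (_ : _ \o _ = @tnth _ Z ^~ (lift u j)); first exact: measurable_tnth.
by apply/funext => t /=; rewrite /del_tuple tnth_mktuple.
Qed.

(** * Joint law of the reduced sample and the deleted point *)

Section leave_one_out_law.
Context d dO (Z : measurableType d) (O : measurableType dO) (R : realType).
Variables (Pr : probability O R) (P : probability Z R) (m : nat).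
Variables (S : O -> m.+1.-tuple Z) (S' : O -> m.-tuple Z).
Hypotheses (hS : iid_sample Pr P S) (hS' : iid_sample Pr P S').
Variable u : 'I_m.+1.
Local Open Scope ereal_scope.

Let mS : measurable_fun setT S := hS.1.
Let mS' : measurable_fun setT S' := hS'.1.

Let mdel : measurable_fun setT (fun o => del_tuple (S o) u : m.-tuple Z).
Proof. exact: measurableT_comp (measurable_del_tuple u) mS. Qed.

Let mnth : measurable_fun setT (fun o => tnth (S o) u).
Proof. exact: measurableT_comp (measurable_tnth u) mS. Qed.

Let mdelnth :
  measurable_fun setT (fun o => (del_tuple (S o) u : m.-tuple Z, tnth (S o) u)).
Proof. exact/measurable_fun_pair. Qed.

(** For fixed [C] both sides are finite measures in [A]: [m1] pushes forward [Pr] restricted to the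
    event that the deleted point lies in [C], and [m2] is the law of [S'] scaled by [P C]. It
    suffices to compare them on boxes. *)
Let law_rect (A : set (m.-tuple Z)) (C : set Z) : measurable A -> measurable C ->
  Pr ((fun o => del_tuple (S o) u) @^-1` A `&` (fun o => tnth (S o) u) @^-1` C) =
  Pr (S' @^-1` A) * P C.
Proof.
move=> mA mC.
have mSC : measurable ((fun o => tnth (S o) u) @^-1` C).
  by rewrite -[X in measurable X]setTI; exact: mnth.
have PC : (0 <= fine (P C))%R by rewrite fine_ge0.
pose X' : {mfun O >-> m.-tuple Z} := mfun_Sub (mem_set mS').
pose m1 : {measure set (m.-tuple Z) -> \bar R} :=
  measure_function_pushforward__canonical__measure_function_Measure
    (mrestr Pr mSC) mdel.
pose m2 : {measure set (m.-tuple Z) -> \bar R} :=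
  mscale (NngNum PC) (distribution Pr X').
have m2E B : m2 B = Pr (S' @^-1` B) * P C.
  by rewrite muleC -[X in X * _]fineK// fin_num_measure.
rewrite -m2E -[LHS]/(m1 A).
apply: tuple_measure_unique mA.
  rewrite /m1/= /pushforward /mrestr preimage_setT setTI.
  by rewrite -ge0_fin_numE// fin_num_measure.
move=> B mB; rewrite m2E (hS'.2 B mB) muleC /m1/= /pushforward /mrestr.
(* Inserting [C] at coordinate [u] gives a box for the full sample. *)
pose B' i := if unlift u i is Some j then B j else C.
have mB' i : measurable (B' i) by rewrite /B'; case: unliftP.
have B'u : B' u = C by rewrite /B' unlift_none.
have B'l j : B' (lift u j) = B j by rewrite /B' liftK.
have := hS.2 B' mB'; rewrite (bigD1_ord u)//= B'u.
under eq_bigr do rewrite B'l.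
move=> <-; congr (Pr _); apply/seteqP; split => o /=.
  move=> [Bo Co] i; have [j|] := unliftP u i => ->; last by rewrite B'u.
  by have := Bo j; rewrite B'l /del_tuple tnth_mktuple.
move=> B'o; split; last by have := B'o u; rewrite B'u.
by move=> j; have := B'o (lift u j); rewrite B'l /del_tuple tnth_mktuple.
Qed.

(** The reduced sample and the deleted point have joint law the product of the law of [S'] and [P],
    whatever [u] is; Fubini then gives the iterated integral. Boundedness makes the signed [f]
    integrable. *)
Lemma integral_leave_one_out (f : m.-tuple Z * Z -> R) :
  measurable_fun setT f -> (exists c, forall x, `|f x| <= c)%R ->
  \int[Pr]_o (f (del_tuple (S o) u, tnth (S o) u))%:E =
  \int[Pr]_o \int[P]_z (f (S' o, z))%:E.
Proof.
move=> mf [c fc].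
pose X' : {mfun O >-> m.-tuple Z} := mfun_Sub (mem_set mS').
pose Y : {mfun O >-> (m.-tuple Z * Z)%type} := mfun_Sub (mem_set mdelnth).
have mEf : measurable_fun setT (EFin \o f) by exact/measurable_EFinP.
have bounded_int dT (T : measurableType dT)
    (mu : {finite_measure set T -> \bar R}) (g : T -> R) :
    measurable_fun setT g -> (forall x, `|g x| <= c)%R ->
    mu.-integrable setT (EFin \o g).
  move=> mg gc; apply: (le_integrable measurableT _ _
    (finite_measure_integrable_cst mu c measurableT)).
    exact/measurable_EFinP.
  by move=> x _; rewrite /= lee_fin (le_trans (gc x))// ler_norm.
transitivity (\int[distribution Pr Y]_x (f x)%:E).
  rewrite integral_distribution//.
  apply: (bounded_int _ _ Pr (f \o Y)); last by move=> o; exact: fc.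
  exact: measurableT_comp.
transitivity (\int[distribution Pr X' \x P]_x (f x)%:E).
  apply: eq_measure_integral => A mA _; apply/esym.
  by apply: product_measure_unique mA => B C mB mC; exact: law_rect.
have fi : (distribution Pr X' \x P).-integrable setT (EFin \o f).
  apply/integrableP; split=> //.
  apply: (@le_lt_trans _ _ (\int[distribution Pr X' \x P]_x (cst c%:E x))).
    by apply: le_integral_pointwise => x; rewrite lee_fin.
  have pT : (distribution Pr X' \x P) setT = 1.
    rewrite -setXTT product_measure1E//.
    by rewrite [X in X * _]probability_setT [X in _ * X]probability_setT mule1.
  by rewrite integral_cst// [X in _ * X]pT mule1 ltry.
have mF := measurable_fubini_F fi.
rewrite -integral12_prod_meas1// integral_distribution//.
apply: (le_integrable measurableT _ _
  (finite_measure_integrable_cst Pr c measurableT)).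
  exact: measurableT_comp.
move=> o _ /=; apply: (le_trans (le_abse_integral _ measurableT _)).
  exact: measurableT_comp mEf (pair1_measurable _).
apply: (@le_trans _ _ (\int[P]_z (cst c%:E z))).
  by apply: le_integral_pointwise => z; rewrite lee_fin.
by rewrite integral_cst// [X in _ * X]probability_setT mule1 lee_fin ler_norm.
Qed.

End leave_one_out_law.

(** * Losses averaged over the randomness of the algorithm *)

Section kernel_fst.
Context dT dZ dW (T : measurableType dT) (Z : measurableType dZ)
  (W : measurableType dW) (R : realType).
Variable k : R.-pker T ~> W.

(** The kernel is extended to pairs so that the test point becomes a parameter too; this yields
    joint measurability of [kernel_loss]. *)
Definition kernel_fst (x : T * Z) : {measure set W -> \bar R} := k x.1.

Let measurable_kernel_fst U : measurable U ->
  measurable_fun [set: T * Z] (kernel_fst ^~ U).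
Proof.
by move=> mU; exact: measurableT_comp (measurable_kernel k U mU) measurable_fst.
Qed.

HB.instance Definition _ :=
  isKernel.Build _ _ _ _ _ kernel_fst measurable_kernel_fst.

Let kernel_fst_setT x : kernel_fst x setT = 1%E.
Proof. exact: prob_kernel. Qed.

HB.instance Definition _ :=
  Kernel_isProbability.Build _ _ _ _ _ kernel_fst kernel_fst_setT.

End kernel_fst.

Section expected_loss.
Context dT dZ dW (T : measurableType dT) (Z : measurableType dZ)
  (W : measurableType dW) (R : realType).
Variables (A : R.-pker T ~> W) (loss : W -> Z -> R).
Hypothesis loss_meas : measurable_fun [set: W * Z] (fun p => loss p.1 p.2).
Hypothesis loss_01 : forall w z, 0 <= loss w z <= 1.

Definition kernel_loss (x : T * Z) : R := \int[A x.1]_w loss w x.2.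

Lemma measurable_lossl z : measurable_fun [set: W] (loss ^~ z).
Proof. exact: measurableT_comp loss_meas (pair2_measurable z). Qed.

Lemma integrable_loss t z : (kprob A t).-integrable setT (EFin \o loss ^~ z).
Proof. by apply: integrable_01 => //; exact: measurable_lossl. Qed.

Lemma EFin_kernel_loss t z :
  (kernel_loss (t, z))%:E = (\int[kprob A t]_w (loss w z)%:E)%E.
Proof. by rewrite fineK//; exact: integrable_fin_num (integrable_loss t z). Qed.

Lemma kernel_loss_01 x : 0 <= kernel_loss x <= 1.
Proof.
case: x => t z; rewrite -!lee_fin EFin_kernel_loss; apply/andP; split.
  by apply: integral_ge0 => w _; rewrite lee_fin; have /andP[] := loss_01 w z.
apply: (@le_trans _ _ (\int[kprob A t]_w (cst 1%:E w)))%E.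
  by apply: le_integral_pointwise => w; rewrite lee_fin; have /andP[] := loss_01 w z.
by rewrite integral_cst// [X in (_ * X)%E]probability_setT mule1.
Qed.

Lemma measurable_kernel_loss : measurable_fun setT kernel_loss.
Proof.
apply/measurable_EFinP.
rewrite (_ : EFin \o _ = fun x => (\int[kernel_fst A x]_w (loss w x.2)%:E)%E).
  apply: (@measurable_fun_integral_finite_kernel _ _ _ _ _
    (fun p : (T * Z) * W => (loss p.2 p.1.2)%:E) (kernel_fst (Z := Z) A)).
    by move=> p; rewrite lee_fin; have /andP[] := loss_01 p.2 p.1.2.
  apply/measurable_EFinP.
  apply: (measurableT_comp loss_meas (g := fun p : T * Z * W => (p.2, p.1.2))).
  by apply/measurable_fun_pair => //=; exact: measurableT_comp.
by apply/funext => -[t z] /=; rewrite EFin_kernel_loss.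
Qed.

Lemma integral_true_loss (P : probability Z R) t :
  (\int[kprob A t]_w true_loss P loss w = \int[P]_z (kernel_loss (t, z))%:E)%E.
Proof.
under [RHS]eq_integral do rewrite EFin_kernel_loss.
apply: (@fubini_tonelli _ _ _ _ _ (kprob A t) P (fun p => (loss p.1 p.2)%:E)).
  exact/measurable_EFinP.
by move=> p; rewrite lee_fin; have /andP[] := loss_01 p.1 p.2.
Qed.

Lemma integrable_true_loss (P : probability Z R) t :
  (kprob A t).-integrable setT (true_loss P loss).
Proof.
have mt : measurable_fun setT (true_loss P loss).
  apply: (@measurable_fun_fubini_tonelli_F _ _ _ _ _ P
    (fun p => (loss p.1 p.2)%:E)); first exact/measurable_EFinP.
  by move=> p; rewrite lee_fin; have /andP[] := loss_01 p.1 p.2.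
apply: (le_integrable measurableT mt _
  (finite_measure_integrable_cst (kprob A t) 1 measurableT)).
move=> w _; rewrite /= normr1 gee0_abs; last first.
  by apply: integral_ge0 => z _; rewrite lee_fin; have /andP[] := loss_01 w z.
apply: (@le_trans _ _ (\int[P]_z (cst 1%:E z)))%E.
  by apply: le_integral_pointwise => z; rewrite lee_fin; have /andP[] := loss_01 w z.
by rewrite integral_cst// [X in (_ * X)%E]probability_setT mule1.
Qed.

End expected_loss.

(** * The generalization gap at one held-out point *)

Section loss_gap.
Context dZ dW (Z : measurableType dZ) (W : measurableType dW) (R : realType).
Variables (m : nat) (A : R.-pker (m.-tuple Z) ~> W) (loss : W -> Z -> R).
Hypothesis loss_meas : measurable_fun [set: W * Z] (fun p => loss p.1 p.2).
Hypothesis loss_01 : forall w z, 0 <= loss w z <= 1.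

Let F := kernel_loss A loss.

(** The test loss is taken at the single point [x.2]; integrating that point against [P] recovers
    the true loss. *)
Definition loss_gap (x : m.-tuple Z * Z) : R :=
  F x - m%:R^-1 * \sum_(i < m) F (x.1, tnth x.1 i).

Let normF x : `|F x| <= 1.
Proof. by have /andP[? ?] := kernel_loss_01 A loss_meas loss_01 x; rewrite ger0_norm. Qed.

Lemma loss_gap_bounded : exists c, forall x, `|loss_gap x| <= c.
Proof.
exists (1 + m%:R^-1 * m%:R) => x.
apply: (le_trans (ler_normB _ _)); apply: lerD => //.
rewrite normrM ger0_norm ?invr_ge0// ler_wpM2l ?invr_ge0//.
apply: (le_trans (ler_norm_sum _ _ _)).
apply: (@le_trans _ _ (\sum_(i < m) 1)); first by apply: ler_sum => i _.
by rewrite sumr_const card_ord.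
Qed.

Lemma measurable_loss_gap : measurable_fun setT loss_gap.
Proof.
have mF := measurable_kernel_loss A loss_meas loss_01.
apply: measurable_funB => //; apply: measurable_funM => //.
apply: measurable_sum => i; apply: (measurableT_comp mF).
apply/measurable_fun_pair => //=.
exact: measurableT_comp (measurable_tnth i) measurable_fst.
Qed.

(** Tonelli brings the inner integral of [gen] into the form treated by [integral_leave_one_out]. *)
Lemma integral_loss_gap (P : probability Z R) t :
  (\int[A t]_w (true_loss P loss w - (emp_loss loss w t)%:E) =
   \int[P]_z (loss_gap (t, z))%:E)%E.
Proof.
have iFz : P.-integrable setT (EFin \o fun z => F (t, z)).
  apply: integrable_01; last by move=> z; exact: kernel_loss_01.
  exact: measurableT_comp (measurable_kernel_loss _ _ _) (pair1_measurable t).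
have iemp i : (kprob A t).-integrable setT
    (fun w => (loss w (tnth t i))%:E).
  exact: integrable_loss.
have isum : (kprob A t).-integrable setT
    (fun w => \sum_(i < m) (loss w (tnth t i))%:E)%E.
  by apply: integrable_sum => //.
have empE w : (emp_loss loss w t)%:E =
    ((m%:R^-1)%:E * \sum_(i < m) (loss w (tnth t i))%:E)%E.
  by rewrite /emp_loss EFinM sumEFin.
under eq_integral do rewrite empE.
(* Same measure, now carrying its structure of probability. *)
transitivity (\int[kprob A t]_w (true_loss P loss w -
    (m%:R^-1)%:E * \sum_(i < m) (loss w (tnth t i))%:E))%E; first by [].
rewrite integralB//; [|exact: integrable_true_loss|exact: integrableZl].
rewrite integralZl// integral_sum// integral_true_loss//.
under [X in (_ - _ * X)%E]eq_bigr do rewrite -EFin_kernel_loss//.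
rewrite sumEFin -EFinM -/F; set c := m%:R^-1 * _.
under [RHS]eq_integral => z _.
  rewrite (_ : loss_gap (t, z) = F (t, z) - cst c z)// EFinB; over.
rewrite integralB_EFin//; last exact: finite_measure_integrable_cst.
have -> : (\int[P]_z (cst c z)%:E)%E = c%:E.
  rewrite -[LHS]/(\int[P]_z (cst c%:E z))%E integral_cst//.
  by rewrite [X in (_ * X)%E]probability_setT mule1.
by [].
Qed.

End loss_gap.

(** * The bound for a fixed data set, and its expectation *)

Lemma average_loss_gap dZ dW (Z : measurableType dZ) (W : measurableType dW)
    (R : realType) (m : nat) (A : R.-pker (m.+1.-tuple Z) ~> W)
    (loss : W -> Z -> R) (t : m.+2.-tuple Z) :
  measurable_fun [set: W * Z] (fun p => loss p.1 p.2) ->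
  (forall w z, 0 <= loss w z <= 1) ->
  ((`|m.+2%:R^-1 *
      \sum_(u < m.+2) loss_gap A loss (del_tuple t u, tnth t u)|)%:E <=
   ((m.+2%:R / m.+1%:R) / Num.sqrt 2)%:E *
     sqrte (@loo_CMI _ _ _ _ _ m.+2 A t))%E.
Proof.
move=> loss_meas loss_01.
pose Q := fun u : 'I_m.+2 => (kprob A (del_tuple t u) : probability W R).
pose f u w := loss w (tnth t u).
have mf u : measurable_fun setT (f u) by exact: measurable_lossl.
have f01 u w : 0 <= f u w <= 1 by exact: loss_01.
pose a u v := \int[Q u]_w f v w.
have gapE u : loss_gap A loss (del_tuple t u, tnth t u) =
    a u u - m.+1%:R^-1 * \sum_(j < m.+1) a u (lift u j).
  rewrite /loss_gap; congr (_ - _ * _); apply: eq_bigr => j _.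
  by rewrite /= /del_tuple tnth_mktuple.
under eq_bigr do rewrite gapE.
(* The factor [n/(n-1)] splits off, leaving the deviation of each trained model from the mixture at
   its own deleted point. *)
rewrite leave_one_out_average normrM ger0_norm ?divr_ge0// EFinM.
rewrite [X in (_ <= X * _)%E]EFinM -muleA lee_wpmul2l ?lee_fin ?divr_ge0//.
have := expectation_gap_mixture Q mf f01.
by under eq_bigr do rewrite Rintegral_mixture//.
Qed.

Theorem theorem1 (R : realType) (dX dY dW dO : measure_display)
  (X : measurableType dX) (Y : measurableType dY) (W : measurableType dW)
  (O : measurableType dO) (Pr : probability O R)
  (n : nat) (n_ge2 : (2 <= n)%N)
  (P : probability (X * Y)%type R)
  (A : R.-pker ((n.-1).-tuple (X * Y)%type) ~> W)
  (loss : W -> (X * Y)%type -> R)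
  (loss_meas : measurable_fun [set: W * (X * Y)%type]
                 (fun p : W * (X * Y)%type => loss p.1 p.2))
  (loss_01 : forall w z, 0 <= loss w z <= 1)
  (S : O -> n.-tuple (X * Y)%type) (S' : O -> (n.-1).-tuple (X * Y)%type)
  (hS : iid_sample Pr P S) (hS' : iid_sample Pr P S') :
  (gen Pr P A loss S'
    <= ((n%:R / (n.-1)%:R) / Num.sqrt 2)%:E
       * \int[Pr]_o sqrte (loo_CMI A (S o)))%E.
Proof.
(* Writing [n = m + 2] makes both [n] and [n - 1] successors, hence invertible. *)
case: n n_ge2 A S S' hS hS' => [//|[//|m]] _ A S S' hS hS'.
have [mgap gap_bounded] := (measurable_loss_gap A loss_meas loss_01,
  loss_gap_bounded A loss_meas loss_01).
pose gap u o := loss_gap A loss (del_tuple (S o) u, tnth (S o) u).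
have mgapu u : measurable_fun setT (gap u).
  apply: (measurableT_comp mgap); apply/measurable_fun_pair.
    exact: measurableT_comp (measurable_del_tuple u) hS.1.
  exact: measurableT_comp (measurable_tnth u) hS.1.
have igapu u : Pr.-integrable setT (EFin \o gap u).
  have [c gapc] := gap_bounded.
  apply: (le_integrable measurableT _ _
    (finite_measure_integrable_cst Pr c measurableT)).
    exact/measurable_EFinP.
  by move=> o _; rewrite /= lee_fin (le_trans (gapc _))// ler_norm.
rewrite /gen; under eq_integral do rewrite integral_loss_gap//.
set I := (X in `|X|%E).
have gapE u : (\int[Pr]_o (gap u o)%:E = I)%E.
  exact: integral_leave_one_out hS hS' u _ mgap gap_bounded.
have Ifin : I \is a fin_num.
  by rewrite -(gapE ord0); exact: integrable_fin_num (igapu ord0).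
pose avg o := m.+2%:R^-1 * \sum_(u < m.+2) gap u o.
have mavg : measurable_fun setT avg.
  by apply: measurable_funM => //; exact: measurable_sum.
(* All [n] expectations equal [I], so their average does too; the average is bounded for each data
   set, unlike its separate terms. *)
have -> : I = (\int[Pr]_o (avg o)%:E)%E.
  under eq_integral do rewrite EFinM -sumEFin.
  rewrite integralZl//; last first.
    by apply: integrable_sum => // u _; exact: igapu.
  rewrite integral_sum// (eq_bigr (fun=> I)); last by move=> u _; exact: gapE.
  rewrite -(fineK Ifin) sumEFin -EFinM sumr_const card_ord.
  by rewrite -[X in (_ * X)%R]mulr_natl mulrA mulVf// mul1r.
set c := m.+2%:R / m.+1%:R / Num.sqrt 2.
have c0 : 0 < c by rewrite /c !divr_gt0// sqrtr_gt0.
apply: le_trans (le_abse_integral _ measurableT _) _.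
  exact/measurable_EFinP.
(* The constant is extracted on the left, where the integrand is measurable, so that the right-hand
   integral is used only through monotonicity. *)
have -> : (\int[Pr]_o `|(avg o)%:E| =
    c%:E * \int[Pr]_o (c^-1%:E * `|(avg o)%:E|))%E.
  rewrite ge0_integralZl_EFin//; last 2 first.
  - by apply: measurableT_comp => //; exact/measurable_EFinP.
  - by rewrite invr_ge0 ltW.
  by rewrite muleA -EFinM divff ?mul1e// gt_eqF.
rewrite lee_pmul2l// ?lte_fin//; apply: le_integral_pointwise => o.
by rewrite lee_pdivrMl//; exact: average_loss_gap.
Qed.
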